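(* Let $C_i$ be a doubly even code of length $m_i$ for $i=1,2$, and let $R_i$ be a subcode of $C_i\cap\operatorname{Rad}C_i$. If $f\in\Phi(C_1/R_1,C_2/R_2)$, then the code $D(C_1,C_2,R_1,R_2,f)$ is a triply even code of length $m_1+m_2$ and of dimension $\dim C_1+\dim R_2=\dim R_1+\dim C_2$.
   Context: A code of length $n$ is a linear subspace of $\mathbb{F}_2^n$; a subcode is a linear subspace. $\operatorname{wt}(u)$ is the number of nonzero coordinates of $u$. A code is doubly even (resp. triply even) if every codeword has weight divisible by $4$ (resp. $8$). $C^\perp$ is the dual with respect to the standard inner product. For $u,v\in\mathbb{F}_2^n$, $u\ast v$ is the vector whose support is the intersection of the supports of $u$ and $v$. $(u|v)$ denotes concatenation. For a doubly even code $C$ define $B:C\times C^\perp\to\mathbb{F}_2$, $B(v,u)=\frac{\operatorname{wt}(v\ast u)}{2}\bmod 2$; $\operatorname{rad}C=\{y\in C^\perp\mid B(x,y)=0\ \text{for all } x\in C\}$; $\operatorname{Rad}C=\{x\in\operatorname{rad}C\mid \operatorname{wt}(x)\equiv0\pmod 8\}$. For doubly even codes $C_1,C_2$ and subcodes $R_i\subset C_i\cap\operatorname{Rad}C_i$, an isometry is a bijective linear map $f:C_1/R_1\to C_2/R_2$ such that $\operatorname{wt}(x_1)\equiv\operatorname{wt}(x_2)\pmod 8$ for any $x_1+R_1\in C_1/R_1$ and any $x_2\in C_2$ with $x_2+R_2=f(x_1+R_1)$. The set of isometries is $\Phi(C_1/R_1,C_2/R_2)$. For $f\in\Phi(C_1/R_1,C_2/R_2)$,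 $$D(C_1,C_2,R_1,R_2,f)=\{(x_1|x_2)\mid x_1\in C_1,\ x_2\in f(x_1+R_1)\}.$$ *)

(* Defs.v *)
From HB Require Import structures.
From mathcomp Require Import all_boot all_order all_algebra.

Set Implicit Arguments.
Unset Strict Implicit.
Unset Printing Implicit Defensive.

Import GRing.Theory.
Local Open Scope ring_scope.
Local Open Scope quotient_scope.

Section QuotientSpace.

Variables (K : fieldType) (V : vectType K) (C R : {vspace V}).

(* R, viewed inside the vector space [subvs_of C]; when R is not contained in
   C this is the intersection of R and C. *)
Definition subcode_pred : {pred subvs_of C} := [pred x | vsval x \in R].

Fact subcode_pred_closed : zmod_closed subcode_pred.
Proof.
split=> [|x y]; rewrite !inE ?linear0 ?mem0v // linearB; exact: memvB.
Qed.

HB.instance Definition _ :=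
  GRing.isZmodClosed.Build (subvs_of C) subcode_pred subcode_pred_closed.

Definition quotvs := Quotient.quot subcode_pred.

HB.instance Definition _ := GRing.Zmodule.on quotvs.

Fact quotvsW (P : quotvs -> Prop) :
  (forall x, P (\pi_quotvs x)) -> forall q, P q.
Proof. by move=> Ppi q; rewrite -[q]reprK. Qed.

Definition quotvs_scale (a : K) (q : quotvs) : quotvs :=
  \pi_quotvs (a *: repr q).

Fact pi_quotvs_scale a (x : subvs_of C) :
  quotvs_scale a (\pi_quotvs x) = \pi_quotvs (a *: x).
Proof.
have /eqP: repr (\pi_quotvs x) = x %[mod quotvs] by rewrite reprK.
rewrite -Quotient.idealrBE inE => Rx.
apply/eqP; rewrite -Quotient.idealrBE inE -scalerBr linearZ /=; exact: memvZ.
Qed.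

Fact quotvs_scaleA a b q :
  quotvs_scale a (quotvs_scale b q) = quotvs_scale (a * b) q.
Proof. by elim/quotvsW: q => x; rewrite !pi_quotvs_scale scalerA. Qed.

Fact quotvs_scale1 : left_id 1 quotvs_scale.
Proof. by elim/quotvsW=> x; rewrite pi_quotvs_scale scale1r. Qed.

Fact quotvs_scaleDr : right_distributive quotvs_scale +%R.
Proof.
move=> a; elim/quotvsW=> x; elim/quotvsW=> y.
by rewrite -raddfD !pi_quotvs_scale scalerDr raddfD.
Qed.

Fact quotvs_scaleDl q : {morph quotvs_scale^~ q : a b / a + b}.
Proof.
by move=> a b; elim/quotvsW: q => x; rewrite !pi_quotvs_scale scalerDl raddfD.
Qed.

HB.instance Definition _ := GRing.Zmodule_isLmodule.Build K quotvs
  quotvs_scaleA quotvs_scale1 quotvs_scaleDr quotvs_scaleDl.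

(* The coset x + R, meaningful only for x \in C: [vsproj C] is the identity on
   C, but sends the other vectors to an arbitrary projection on C. *)
Definition cosetvs (x : V) : quotvs := \pi_quotvs (vsproj C x).

Lemma cosetvs_eq x y :
  x \in C -> y \in C -> (cosetvs x == cosetvs y) = (x - y \in R).
Proof.
by move=> Cx Cy; rewrite -Quotient.idealrBE inE linearB /= !vsprojK.
Qed.

End QuotientSpace.

Section Codes.

Variable n : nat.
Implicit Types (u v : 'rV['F_2]_n) (C : {vspace 'rV['F_2]_n}).

Definition wt u : nat := #|[set i | u 0 i != 0]|.

Definition doubly_even C : Prop := forall u, u \in C -> (4 %| wt u)%N.

Definition triply_even C : Prop := forall u, u \in C -> (8 %| wt u)%N.

Definition dot u v : 'F_2 := \sum_i u 0 i * v 0 i.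

Definition dual_code C : {set 'rV['F_2]_n} :=
  [set y | [forall x in C, dot x y == 0]].

Definition star u v : 'rV['F_2]_n := \row_i (u 0 i * v 0 i).

(* For v \in C and u \in dual_code C the weight of [star v u] is even, so that
   the division is exact; the cast to 'F_2 is the reduction modulo 2. *)
Definition B v u : 'F_2 := (wt (star v u) %/ 2)%:R.

Definition rad_code C : {set 'rV['F_2]_n} :=
  [set y in dual_code C | [forall x in C, B x y == 0]].

Definition Rad_code C : {set 'rV['F_2]_n} :=
  [set x in rad_code C | (8 %| wt x)%N].

(* The quotient element q as a subset of the ambient space. *)
Definition coset_set C R (q : quotvs C R) : {set 'rV['F_2]_n} :=
  [set x in C | cosetvs C R x == q].

End Codes.

Section Gluing.

Variables (m1 m2 : nat).
Variables (C1 : {vspace 'rV['F_2]_m1}) (C2 : {vspace 'rV['F_2]_m2}).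
Variables (R1 : {vspace 'rV['F_2]_m1}) (R2 : {vspace 'rV['F_2]_m2}).

Definition is_isometry (f : quotvs C1 R1 -> quotvs C2 R2) : Prop :=
  [/\ linear f, bijective f &
      forall x1 x2, x1 \in C1 -> x2 \in C2 ->
        cosetvs C2 R2 x2 = f (cosetvs C1 R1 x1) -> (wt x1 = wt x2 %[mod 8])%N].

Definition glued (f : quotvs C1 R1 -> quotvs C2 R2) :
    {set 'rV['F_2]_(m1 + m2)} :=
  [set row_mx x1 x2 | x1 in C1, x2 in coset_set (f (cosetvs C1 R1 x1))].

End Gluing.

(* Main.v *)
Require Import Defs.
From mathcomp Require Import all_boot all_order all_algebra.
From HB Require Import structures.

(** The glued code is the fibre product of [C1] and [C2] over the quotient
    [C2 / R2], along [C1 -> C1 / R1 -> C2 / R2] and [C2 -> C2 / R2]: a word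
    [(x1 | x2)] belongs to it exactly when [x1] and [x2] are codewords whose
    cosets correspond under [f] ([mem_glued_row]).  The condition is linear, so
    the glued words form a subspace [D].

    Triple evenness is immediate: [wt (x1 | x2) = wt x1 + wt x2], the isometry
    makes the two terms congruent modulo 8, and twice a multiple of 4 is a
    multiple of 8.

    For the dimension, apply rank-nullity to the two projections of [D].
    The left one has image [C1], because every coset of [R2] is nonempty, and
    its kernel is a copy of [R2], because [f 0 = 0].  The right one has image
    [C2] and kernel a copy of [R1], because [f] is bijective.  The two resulting
    expressions of [\dim D] are the ones to be compared. *)

Set Implicit Arguments.
Unset Strict Implicit.
Unset Printing Implicit Defensive.

Import GRing.Theory.

Section Auxiliary.

Local Open Scope ring_scope.

Lemma span_submod_closed (K : fieldType) (V : vectType K) (X : seq V) :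
  submod_closed [pred x in X] -> <<X>>%VS =i X.
Proof.
case=> X0 XS x; apply/idP/idP; last exact: memv_span.
move=> /(coord_span (X := in_tuple X)) ->.
elim/big_ind: _ => [//|u v Xu Xv|i _].
  by rewrite -[u]scale1r; apply: XS.
by rewrite -[_ *: _]addr0; apply: XS => //; apply: mem_nth.
Qed.

(** Rank-nullity for [p] on [D]; since [q] is injective on the kernel of [p],
    it measures the dimension of that kernel. *)
Lemma dim_joint_projections (K : fieldType) (U V W : vectType K)
    (D : {vspace U}) (A : {vspace V}) (E : {vspace W})
    (p : 'Hom(U, V)) (q : 'Hom(U, W)) :
    (forall d, p d = 0 -> q d = 0 -> d = 0) ->
    (forall a, a \in A <-> exists2 d, d \in D & p d = a) ->
    (forall e, e \in E <-> exists d, [/\ d \in D, p d = 0 & q d = e]) ->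
  \dim D = (\dim A + \dim E)%N.
Proof.
move=> pq_inj imp kerp; rewrite -(limg_ker_dim p D) addnC; congr (_ + _)%N.
  congr (\dim _); apply/vspaceP=> a; apply/memv_imgP/idP.
    by case=> d Dd ->; apply/imp; exists d.
  by case/imp=> d Dd <-; exists d.
rewrite -(limg_dim_eq (f := q)); last first.
  apply/eqP; rewrite -subv0; apply/subvP=> d.
  rewrite !memv_cap !memv_ker memv0 => /andP[/andP[_ /eqP pd] /eqP qd].
  by apply/eqP; apply: pq_inj.
congr (\dim _); apply/vspaceP=> e; apply/memv_imgP/idP.
  case=> d; rewrite memv_cap memv_ker => /andP[Dd /eqP pd] ->.
  by apply/kerp; exists d.
case/kerp=> d [Dd pd <-]; exists d => //.
by rewrite memv_cap memv_ker Dd pd eqxx.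
Qed.

Lemma linear_fun0 (K : fieldType) (U V : lmodType K) (g : U -> V) :
  linear g -> g 0 = 0.
Proof. by move=> /(_ (-1) 0 0); rewrite scaler0 addr0 scaleN1r addNr. Qed.

Lemma cosetvs_is_linear (K : fieldType) (V : vectType K) (C R : {vspace V}) :
  linear (cosetvs C R).
Proof.
by move=> a x y; rewrite /cosetvs linearP raddfD /= -pi_quotvs_scale.
Qed.

HB.instance Definition _ (K : fieldType) (V : vectType K) (C R : {vspace V}) :=
  GRing.isLinear.Build K V (quotvs C R) _ (cosetvs C R)
    (@cosetvs_is_linear K V C R).

Lemma cosetvs_eq0 (K : fieldType) (V : vectType K) (C R : {vspace V}) x :
  x \in C -> (cosetvs C R x == 0) = (x \in R).
Proof.
by move=> Cx; rewrite -[0](linear0 (cosetvs C R)) cosetvs_eq ?mem0v ?subr0.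
Qed.

Lemma cosetvs_surj (K : fieldType) (V : vectType K) (C R : {vspace V})
    (q : quotvs C R) :
  exists2 x, x \in C & cosetvs C R x = q.
Proof.
elim/quotvsW: q => x; exists (vsval x); first exact: subvsP.
by rewrite /cosetvs vsvalK.
Qed.

Lemma wt_row_mx m1 m2 (x1 : 'rV['F_2]_m1) (x2 : 'rV['F_2]_m2) :
  wt (row_mx x1 x2) = (wt x1 + wt x2)%N.
Proof.
rewrite /wt -!sum1_card big_split_ord /=.
by congr (_ + _)%N; apply: eq_bigl => i; rewrite !inE ?row_mxEl ?row_mxEr.
Qed.

End Auxiliary.

Section Gluing.

Local Open Scope ring_scope.

Variables (m1 m2 : nat).
Variables (C1 R1 : {vspace 'rV['F_2]_m1}) (C2 R2 : {vspace 'rV['F_2]_m2}).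
Variable f : quotvs C1 R1 -> quotvs C2 R2.

Lemma mem_glued_row x1 x2 :
  (row_mx x1 x2 \in glued f) =
  [&& x1 \in C1, x2 \in C2 & cosetvs C2 R2 x2 == f (cosetvs C1 R1 x1)].
Proof.
apply/imset2P/and3P.
  by case=> y1 y2 Cy1; rewrite !inE => /andP[Cy2 ey] /eq_row_mx[-> ->].
by case=> Cx1 Cx2 ex; exists x1 x2; rewrite ?inE ?Cx2.
Qed.

Lemma glued_submod_closed : linear f -> submod_closed [pred x in glued f].
Proof.
move=> f_lin; have f0 := linear_fun0 f_lin.
split=> [|a x y]; rewrite !inE.
  by rewrite -row_mx0 mem_glued_row !mem0v !linear0 f0 /=.
rewrite -[x]hsubmxK -[y]hsubmxK scale_row_mx add_row_mx !mem_glued_row.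
case/and3P=> Cx1 Cx2 /eqP ex /and3P[Cy1 Cy2 /eqP ey].
by rewrite !rpredD ?rpredZ //= !linearP /= ex ey f_lin.
Qed.

Lemma exists_glued_vspace :
  linear f -> exists D : {vspace 'rV['F_2]_(m1 + m2)}, D =i glued f.
Proof.
move=> /glued_submod_closed[g0 gS]; exists <<enum (glued f)>>%VS => x.
rewrite span_submod_closed ?mem_enum //.
split=> [|a u v]; rewrite !inE !mem_enum //; exact: gS.
Qed.

(** Modulo 8, the weight of [(x1 | x2)] is [2 * wt x1], and [4] divides
    [wt x1]. *)
Lemma triply_even_glued (D : {vspace 'rV['F_2]_(m1 + m2)}) :
  D =i glued f -> doubly_even C1 -> is_isometry f -> triply_even D.
Proof.
move=> DE hC1 [_ _ f_wt] x; rewrite DE -[x]hsubmxK mem_glued_row.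
case/and3P=> Cx1 Cx2 /eqP ex.
rewrite wt_row_mx /dvdn -modnDmr -(f_wt _ _ Cx1 Cx2 ex) modnDmr addnn -mul2n.
exact: (@dvdn_mul 2 4 2 _ _ (hC1 _ Cx1)).
Qed.

(** The first projection of [D] is onto [C1] because every coset of [R2] is
    nonempty; [(0 | x2)] is glued exactly when [x2] lies in the zero coset. *)
Lemma dim_glued_left (D : {vspace 'rV['F_2]_(m1 + m2)}) :
    D =i glued f -> linear f -> (R2 <= C2)%VS ->
  \dim D = (\dim C1 + \dim R2)%N.
Proof.
move=> DE f_lin /subvP sRC; have f0 := linear_fun0 f_lin.
apply: (@dim_joint_projections _ _ _ _ _ _ _ (linfun lsubmx) (linfun rsubmx)).
- by move=> x; rewrite !lfunE /= -{3}[x]hsubmxK => -> ->; rewrite row_mx0.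
- move=> x1; split=> [Cx1|[x]].
    have [x2 Cx2 ex] := cosetvs_surj (f (cosetvs C1 R1 x1)).
    exists (row_mx x1 x2); last by rewrite lfunE /= row_mxKl.
    by rewrite DE mem_glued_row Cx1 Cx2 ex eqxx.
  by rewrite DE -[x]hsubmxK mem_glued_row lfunE /= row_mxKl => /and3P[? _ _] <-.
- move=> x2; split=> [Rx2|[x []]].
    exists (row_mx 0 x2); rewrite !lfunE /= row_mxKl row_mxKr; split=> //.
    rewrite DE mem_glued_row mem0v sRC //= linear0 f0.
    by rewrite cosetvs_eq0 ?sRC.
  rewrite DE -[x]hsubmxK mem_glued_row !lfunE /= row_mxKl row_mxKr.
  case/and3P=> _ Cx2 ex x1_0 <-.
  by rewrite -(cosetvs_eq0 _ Cx2) (eqP ex) x1_0 linear0 f0.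
Qed.

(** Onto [C2] because [f] is surjective; by injectivity of [f], [(x1 | 0)] is
    glued only when [x1] lies in the zero coset. *)
Lemma dim_glued_right (D : {vspace 'rV['F_2]_(m1 + m2)}) :
    D =i glued f -> linear f -> bijective f -> (R1 <= C1)%VS ->
  \dim D = (\dim C2 + \dim R1)%N.
Proof.
move=> DE f_lin f_bij /subvP sRC; have f0 := linear_fun0 f_lin.
have [g fK gK] := f_bij.
apply: (@dim_joint_projections _ _ _ _ _ _ _ (linfun rsubmx) (linfun lsubmx)).
- by move=> x; rewrite !lfunE /= -{3}[x]hsubmxK => -> ->; rewrite row_mx0.
- move=> x2; split=> [Cx2|[x]].
    have [x1 Cx1 ex] := cosetvs_surj (g (cosetvs C2 R2 x2)).
    exists (row_mx x1 x2); last by rewrite lfunE /= row_mxKr.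
    by rewrite DE mem_glued_row Cx1 Cx2 ex gK eqxx.
  by rewrite DE -[x]hsubmxK mem_glued_row lfunE /= row_mxKr => /and3P[_ ? _] <-.
- move=> x1; split=> [Rx1|[x []]].
    exists (row_mx x1 0); rewrite !lfunE /= row_mxKl row_mxKr; split=> //.
    have /eqP x1_0 : cosetvs C1 R1 x1 == 0 by rewrite cosetvs_eq0 ?sRC.
    by rewrite DE mem_glued_row mem0v sRC //= x1_0 linear0 f0.
  rewrite DE -[x]hsubmxK mem_glued_row !lfunE /= row_mxKl row_mxKr.
  case/and3P=> Cx1 _ ex x2_0 <-.
  rewrite -(cosetvs_eq0 _ Cx1) -(inj_eq (can_inj fK)) -(eqP ex) x2_0.
  by rewrite linear0 f0.
Qed.

End Gluing.

Theorem proposition19 (m1 m2 : nat)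
    (C1 R1 : {vspace 'rV['F_2]_m1}) (C2 R2 : {vspace 'rV['F_2]_m2})
    (hC1 : doubly_even C1) (hC2 : doubly_even C2)
    (hR1 : {subset R1 <= [predI C1 & Rad_code C1]})
    (hR2 : {subset R2 <= [predI C2 & Rad_code C2]})
    (f : quotvs C1 R1 -> quotvs C2 R2) (hf : is_isometry f) :
  exists D : {vspace 'rV['F_2]_(m1 + m2)},
    [/\ D =i glued f, triply_even D,
        \dim D = \dim C1 + \dim R2 &
        \dim C1 + \dim R2 = \dim R1 + \dim C2].
Proof.
have [f_lin f_bij _] := hf.
have sRC1 : (R1 <= C1)%VS by apply/subvP=> x /hR1 /andP[].
have sRC2 : (R2 <= C2)%VS by apply/subvP=> x /hR2 /andP[].
have [D DE] := exists_glued_vspace f_lin.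
have dimD := dim_glued_left DE f_lin sRC2.
exists D; split=> //; first exact: triply_even_glued DE hC1 hf.
by rewrite -dimD (dim_glued_right DE f_lin f_bij sRC1) addnC.
Qed.
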